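(* Let $D$ be a digraph and $\alpha=(\alpha_v)_{v\in V(D)}$ a family of mutually disjoint digraphs. If the Cartesian product $\sigma(D,\alpha)$ has a semi-Grundy function, then $D$ has a semi-kernel and $\alpha_v$ has a semi-Grundy function for each $v\in V(D)$.
   Context: For a vertex $x$ of a digraph $D$, $\Gamma^+(x)$ denotes the set of out-neighbours of $x$. A function $s:V(D)\to\mathbb{N}$ (with $\mathbb{N}=\{0,1,2,\dots\}$) is a semi-Grundy function of $D$ if (1) whenever $s(x)=k$, every $y\in\Gamma^+(x)$ satisfies $s(y)\neq k$; and (2) whenever $s(x)=k$, $y\in\Gamma^+(x)$ and $s(y)>k$, there exists $z\in\Gamma^+(y)$ with $s(z)=k$. Standing convention of the paper: every semi-Grundy function takes as its set of values a set of consecutive non-negative integers starting at $0$. A set is independent if no arc has both ends in it; a semi-kernel of $D$ is an independent set $S$ such that whenever there is an arc from $S$ to a vertex $z$, there is an arc from $z$ to $S$. Given $D$ and a family $\alpha=(\alpha_v)_{v\in V(D)}$ of mutually disjoint digraphs, the Cartesian product $\sigma(D,\alpha)$ has vertex set $\bigcup_{v}V(\alpha_v)$ and arc set $\bigcup_{v}A(\alpha_v)\cup\{(x,y): x\in V(\alpha_u),\ y\in V(\alpha_v),\ (u,v)\in A(D)\}$. *)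

(* Defs.v *)
From Stdlib Require Import Arith.

(* Digraphs have a non-empty vertex set; they may be infinite and have loops. *)
Record digraph : Type := Digraph {
  vertex : Type;
  arc : vertex -> vertex -> Prop;
  vertex_inhabited : inhabited vertex
}.

Arguments arc {d} x y.

Definition independent (D : digraph) (S : vertex D -> Prop) : Prop :=
  forall x y : vertex D, S x -> S y -> ~ arc x y.

(* Non-emptiness is the usual convention: the empty set satisfies the two other
   conditions in every digraph. *)
Definition semi_kernel (D : digraph) (S : vertex D -> Prop) : Prop :=
  (exists x, S x) /\
  independent D S /\
  forall z : vertex D,
    (exists x, S x /\ arc x z) -> exists y, S y /\ arc z y.

(* The initial segments {0, ..., m} and the whole of nat. *)
Definition consecutive_from_0 (A : nat -> Prop) : Prop :=
  A 0 /\ forall j k : nat, j < k -> A k -> A j.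

Definition semi_grundy (D : digraph) (s : vertex D -> nat) : Prop :=
  (forall (k : nat) (x : vertex D), s x = k ->
     forall y, arc x y -> s y <> k) /\
  (forall (k : nat) (x y : vertex D), s x = k -> arc x y -> k < s y ->
     exists z, arc y z /\ s z = k) /\
  consecutive_from_0 (fun k => exists x, s x = k).

Section CartesianProduct.

Variables (D : digraph) (alpha : vertex D -> digraph).

(* The union of mutually disjoint vertex sets is rendered as a tagged union. *)
Definition product_vertex : Type := {v : vertex D & vertex (alpha v)}.

Inductive product_arc : product_vertex -> product_vertex -> Prop :=
| product_arc_inner (v : vertex D) (x y : vertex (alpha v)) :
    arc x y ->
    product_arc (existT _ v x) (existT _ v y)
| product_arc_outer (u v : vertex D)
    (x : vertex (alpha u)) (y : vertex (alpha v)) :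
    arc u v ->
    product_arc (existT _ u x) (existT _ v y).

Lemma product_vertex_inhabited : inhabited product_vertex.
Proof.
destruct (vertex_inhabited D) as [v].
destruct (vertex_inhabited (alpha v)) as [x].
exact (inhabits (existT _ v x)).
Qed.

Definition cartesian_product : digraph :=
  Digraph product_vertex product_arc product_vertex_inhabited.

End CartesianProduct.

(* Main.v *)
Require Import Defs.
From Stdlib Require Import Arith Lia ClassicalEpsilon.

(** Let [s] be a semi-Grundy function of the product.  An arc of [D] from [u] to
    [v] forces the values of [s] on [alpha u] and on [alpha v] to be disjoint.
    Hence the vertices of [D] whose copy carries the value 0 form a semi-kernel,
    and the successors demanded by the second condition for two vertices of
    [alpha v] always lie in [alpha v] itself.  The restriction of [s] to [alpha v]
    may skip values; composing it with the order isomorphism from its range onto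
    an initial segment of [nat] repairs this. *)

(** Counts the elements of [A] below [n]; restricted to [A], it is the order isomorphism onto an
    initial segment. *)
Fixpoint rank (A : nat -> Prop) (n : nat) : nat :=
  match n with
  | 0 => 0
  | S m => (if excluded_middle_informative (A m) then 1 else 0) + rank A m
  end.

Lemma rank_le (A : nat -> Prop) (i j : nat) : i <= j -> rank A i <= rank A j.
Proof. induction 1; simpl; lia. Qed.

Lemma rank_lt (A : nat -> Prop) (i j : nat) :
  A i -> i < j -> rank A i < rank A j.
Proof.
intros Ai ltij.
apply Nat.lt_le_trans with (rank A (S i)); [simpl | now apply rank_le].
destruct (excluded_middle_informative (A i)); [lia | contradiction].
Qed.

Lemma rank_inj (A : nat -> Prop) (i j : nat) :
  A i -> A j -> rank A i = rank A j -> i = j.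
Proof.
intros Ai Aj eqr.
destruct (Nat.lt_trichotomy i j) as [lt | [eq | lt]]; trivial;
  apply (rank_lt A) in lt; trivial; lia.
Qed.

Lemma rank_lt_reg (A : nat -> Prop) (i j : nat) : rank A i < rank A j -> i < j.
Proof.
intros ltr; destruct (Nat.lt_ge_cases i j) as [lt | le]; trivial.
apply (rank_le A) in le; lia.
Qed.

(** [rank A] grows by at most 1 per step, and only on passing an element of [A], so no value is
    skipped. *)
Lemma rank_surj (A : nat -> Prop) (n m : nat) :
  m < rank A n -> exists k, A k /\ rank A k = m.
Proof.
induction n as [|n IH]; simpl; [lia |].
destruct (excluded_middle_informative (A n)) as [An | _]; [| exact IH].
intros ltm; destruct (Nat.eq_dec m (rank A n)) as [-> | neq].
- now exists n.
- apply IH; lia.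
Qed.

(** Both hypotheses only compare values, so they survive a relabelling that is strictly increasing
    on the range of [s]. *)
Lemma semi_grundy_compress (D : digraph) (s : vertex D -> nat) :
  (forall x y, arc x y -> s y <> s x) ->
  (forall x y, arc x y -> s x < s y -> exists z, arc y z /\ s z = s x) ->
  exists t, semi_grundy D t.
Proof.
intros H1 H2.
set (A := fun k => exists x, s x = k).
assert (As : forall x, A (s x)) by (intros x; now exists x).
assert (surj : forall x m, m < rank A (s x) -> exists y, rank A (s y) = m).
{ intros x m ltm; destruct (rank_surj _ _ _ ltm) as [k [[y <-] eqm]].
  now exists y. }
exists (fun x => rank A (s x)); repeat split.
- intros k x <- y xy eqr.
  now apply (H1 x y xy), (rank_inj A).
- intros k x y <- xy ltr.
  destruct (H2 x y xy (rank_lt_reg _ _ _ ltr)) as [z [yz eqz]].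
  exists z; now rewrite eqz.
- destruct (vertex_inhabited D) as [x].
  destruct (Nat.eq_0_gt_0_cases (rank A (s x))) as [eq0 | gt0].
  + now exists x.
  + now apply (surj x).
- intros j k ltjk [x <-]; now apply (surj x).
Qed.

(* Phrased with projections so that no inversion of equalities between dependent
   pairs, hence no uniqueness of identity proofs, is needed. *)
Lemma product_arc_cases (D : digraph) (alpha : vertex D -> digraph)
    (p q : product_vertex D alpha) :
  product_arc D alpha p q ->
  arc (projT1 p) (projT1 q) \/
  exists z, arc (projT2 p) z /\ q = existT _ (projT1 p) z.
Proof.
intros [v x y xy | u v x y uv]; simpl; [right; now exists y | now left].
Qed.

Section SemiGrundyProduct.

Variables (D : digraph) (alpha : vertex D -> digraph).
Variable s : vertex (cartesian_product D alpha) -> nat.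
Hypothesis s_grundy : semi_grundy (cartesian_product D alpha) s.

Lemma semi_grundy_product_outer_neq (u v : vertex D)
    (x : vertex (alpha u)) (y : vertex (alpha v)) :
  arc u v -> s (existT _ v y) <> s (existT _ u x).
Proof.
intros uv; destruct s_grundy as [H1 _].
apply (H1 _ (existT _ u x) eq_refl); now constructor.
Qed.

Lemma semi_kernel_of_product :
  semi_kernel D (fun v => exists x : vertex (alpha v), s (existT _ v x) = 0).
Proof.
assert (indep : independent D
          (fun v => exists x : vertex (alpha v), s (existT _ v x) = 0)).
{ intros u v [x sx] [y sy] uv.
  apply (semi_grundy_product_outer_neq u v x y uv); congruence. }
(* The value 0 is attained, which makes the set non-empty. *)
destruct s_grundy as [_ [H2 [[[v x] sx] _]]].
split; [now exists v, x | split; [exact indep |]].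
intros z [u [[a sa] uz]].
(* Any [b] serves: its value differs from that of [a], so it exceeds 0. *)
destruct (vertex_inhabited (alpha z)) as [b].
pose proof (semi_grundy_product_outer_neq u z a b uz) as neq.
destruct (H2 0 (existT _ u a) (existT _ z b) sa) as [[w c] [zw sc]];
  [now constructor | lia |].
destruct (product_arc_cases _ _ _ _ zw) as [arczw | [c' [_ eqc]]]; simpl in *.
- exists w; split; [now exists c | exact arczw].
(* A zero inside [alpha z] would put both ends of the arc from [u] to [z] in the set. *)
- exfalso; apply (indep u z); [now exists a | | exact uz].
  exists c'; now rewrite <- eqc.
Qed.

Lemma semi_grundy_factor (v : vertex D) : exists t, semi_grundy (alpha v) t.
Proof.
destruct s_grundy as [H1 [H2 _]].
apply semi_grundy_compress with (fun x => s (existT _ v x)).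
- intros x y xy; apply (H1 _ (existT _ v x) eq_refl); now constructor.
- intros x y xy ltxy.
  destruct (H2 _ (existT _ v x) (existT _ v y) eq_refl) as [[w c] [yw sc]];
    [now constructor | exact ltxy |].
  destruct (product_arc_cases _ _ _ _ yw) as [vw | [z [yz eqz]]]; simpl in *.
  (* Leaving [alpha v] is impossible: [c] has the value of [x], and [v] has an arc to [w]. *)
  + now destruct (semi_grundy_product_outer_neq v w x c vw).
  + exists z; split; [exact yz | now rewrite <- eqz].
Qed.

End SemiGrundyProduct.

Theorem theorem6 (D : digraph) (alpha : vertex D -> digraph) :
  (exists s, semi_grundy (cartesian_product D alpha) s) ->
  (exists S, semi_kernel D S) /\
  (forall v : vertex D, exists s, semi_grundy (alpha v) s).
Proof.
intros [s sg]; split.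
- eexists; exact (semi_kernel_of_product D alpha s sg).
- exact (semi_grundy_factor D alpha s sg).
Qed.
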